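(* Let $\omega(t)\ge0$ be a weighting function on $[0,1]$ and let $\epsilon_\theta:\mathbb{R}^d\times[0,1]\to\mathbb{R}^d$ be a family of functions indexed by a parameter $\theta$. Minimizing over $\theta$ the score loss $$\mathcal{L}(\theta):=\frac12\int_0^1\omega(t)\,\mathbb{E}_{X_t\sim p_t}\Bigl[\bigl\|\epsilon_\theta(X_t,t)+\sigma_t\nabla\log p_t(X_t)\bigr\|_2^2\Bigr]\mathrm{d}t$$ is equivalent, up to an additive constant independent of $\theta$, to minimizing the noise-prediction loss: there is a constant $C$ independent of $\theta$ such that for every $\theta$ $$\mathcal{L}(\theta)=\frac12\int_0^1\omega(t)\,\mathbb{E}_{X_0,\varepsilon}\Bigl[\bigl\|\epsilon_\theta(\alpha_tX_0+\sigma_t\varepsilon,t)-\varepsilon\bigr\|_2^2\Bigr]\mathrm{d}t+C.$$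
   Context: $X_0\in\mathbb{R}^d$ is a random variable with density $p_0$, and $\varepsilon\sim\mathcal{N}(0,I)$ is independent of $X_0$. Schedules: $\alpha_t,\sigma_t$ are differentiable functions of $t\in[0,1]$ with $\alpha_0=1$, $\alpha_1=0$, $\sigma_0=0$, $\sigma_1=1$, $\alpha_t,\sigma_t\ge 0$ on $[0,1]$, $\alpha_t>0$, $\sigma_t>0$ for $t\in(0,1)$, and $\frac{\mathrm{d}}{\mathrm{d}t}\sigma_t^2-2\frac{\dot\alpha_t}{\alpha_t}\sigma_t^2\ge0$. $X_t:=\alpha_tX_0+\sigma_t\varepsilon$ has density $p_t(x)=\int_{\mathbb{R}^d}\mathcal{N}(x;\alpha_tx_0,\sigma_t^2I)p_0(x_0)\,\mathrm{d}x_0$. All functions are measurable, and all displayed expectations and time integrals are assumed finite. *)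

(* Defs.v *)
From HB Require Import structures.
From mathcomp Require Import all_boot all_order all_algebra.
From mathcomp Require Import all_classical all_reals all_analysis.

Set Implicit Arguments.
Unset Strict Implicit.
Unset Printing Implicit Defensive.
Import Order.TTheory GRing.Theory Num.Theory.
Import numFieldNormedType.Exports.

Local Open Scope classical_set_scope.
Local Open Scope ring_scope.

(* R^d is 'rV[R]_d, with the sigma-algebra generated by the coordinate maps
   (i.e. the Borel sigma-algebra). *)
Definition rV_display : measure_display.
Proof. exact: default_measure_display. Qed.

Section measurable_rV.
Context {R : realType} (d : nat).

Let coord (i : 'I_d) (x : 'rV[R]_d) : R := x ord0 i.

Let rV_set0 : g_sigma_preimage coord set0.
Proof. exact: sigma_algebra0. Qed.

Let rV_setC A : g_sigma_preimage coord A -> g_sigma_preimage coord (~` A).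
Proof. exact: sigma_algebraC. Qed.

Let rV_bigcup (F : (set 'rV[R]_d)^nat) :
  (forall i, g_sigma_preimage coord (F i)) ->
  g_sigma_preimage coord (\bigcup_i (F i)).
Proof. exact: sigma_algebra_bigcup. Qed.

HB.instance Definition _ := @isMeasurable.Build
  rV_display 'rV[R]_d
  (g_sigma_preimage coord) rV_set0 rV_setC rV_bigcup.

End measurable_rV.

Section measurable_rV_theory.
Context {R : realType}.

Lemma measurable_rV_coord d (i : 'I_d) :
  measurable_fun setT (fun x : 'rV[R]_d => x ord0 i).
Proof.
move=> _ Y mY; rewrite setTI; apply: sub_sigma_algebra => /=.
rewrite -bigcup_seq/=; exists i => /=; first by rewrite mem_index_enum.
by exists Y => //; rewrite setTI.
Qed.

Lemma measurable_fun_rVP d' (T : measurableType d') d (f : T -> 'rV[R]_d) :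
  measurable_fun setT f <-> forall i, measurable_fun setT (fun x => f x ord0 i).
Proof.
split=> [mf i|mf].
  exact: measurableT_comp (measurable_rV_coord i) mf.
apply: (@measurability _ _ _ _ _ _
  (\big[setU/set0]_(i < d) preimage_set_system setT
     (fun x : 'rV[R]_d => x ord0 i) measurable)).
  by [].
move=> _ [A + <-]; rewrite -bigcup_seq => -[i _ [B mB <-]].
by rewrite setTI; exact: mf.
Qed.

End measurable_rV_theory.

(* Lebesgue measure on R^d, by recursion on d as the image of the product of
   the Lebesgue measures on R and R^d under R * R^d ~ R^(d+1); the Lebesgue
   measure on the one-point space R^0 is the unit mass. *)
Section lebesgue_rV_step.
Context {R : realType} (d : nat).
Local Open Scope ereal_scope.

Definition rV_cons (z : R * 'rV[R]_d) : 'rV[R]_d.+1 :=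
  \row_i oapp (fun j => z.2 ord0 j) z.1 (unlift ord0 i).

Definition rV_uncons (x : 'rV[R]_d.+1) : R * 'rV[R]_d :=
  (x ord0 ord0, \row_j x ord0 (lift ord0 j)).

Lemma rV_consK : cancel rV_cons rV_uncons.
Proof.
case=> a x; rewrite /rV_uncons mxE unlift_none /=; congr pair.
by apply/rowP => j; rewrite !mxE liftK.
Qed.

Lemma measurable_rV_cons : measurable_fun setT rV_cons.
Proof.
apply/measurable_fun_rVP => i.
rewrite (_ : (fun _ => _) = fun z : R * 'rV[R]_d =>
    oapp (fun j => z.2 ord0 j) z.1 (unlift ord0 i)); last first.
  by apply/funext => z; rewrite mxE.
case: unliftP => [j _|_] /=; last exact: measurable_fst.
exact: measurableT_comp (measurable_rV_coord j) measurable_snd.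
Qed.

Lemma measurable_rV_uncons : measurable_fun setT rV_uncons.
Proof.
apply/measurable_fun_pairP; split; first exact: measurable_rV_coord.
apply/measurable_fun_rVP => j.
rewrite (_ : (fun _ => _) = fun x : 'rV[R]_d.+1 => x ord0 (lift ord0 j)).
  exact: measurable_rV_coord.
by apply/funext => x; rewrite mxE.
Qed.

Variable mu : {sigma_finite_measure set 'rV[R]_d -> \bar R}.

Definition lebesgue_rV_step : set 'rV[R]_d.+1 -> \bar R :=
  pushforward (@lebesgue_measure R \x mu) rV_cons.

HB.instance Definition _ := Measure.copy lebesgue_rV_step
  (measure_function_pushforward__canonical__measure_function_Measure
    (@lebesgue_measure R \x mu)%E measurable_rV_cons).

Let step_sigma_finite : sigma_finite setT lebesgue_rV_step.
Proof.
have /sigma_finiteP[F [TF ndF Foo]] := sigma_finiteT (@lebesgue_measure R).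
have /sigma_finiteP[G [TG ndG Goo]] := sigma_finiteT mu.
exists (fun n => rV_uncons @^-1` (F n `*` G n)).
  apply/esym; rewrite -subTset => x _.
  have [n _ Fn] : (\bigcup_n F n) (rV_uncons x).1 by rewrite -TF.
  have [k _ Gk] : (\bigcup_n G n) (rV_uncons x).2 by rewrite -TG.
  exists (maxn n k) => //; split.
  - by move: Fn; exact/subsetPset/ndF/leq_maxl.
  - by move: Gk; exact/subsetPset/ndG/leq_maxr.
move=> n; have [mFn Fn_oo] := Foo n; have [mGn Gn_oo] := Goo n; split.
  rewrite -[X in measurable X]setTI; apply: measurable_rV_uncons => //.
  exact: measurableX.
rewrite /lebesgue_rV_step /pushforward -comp_preimage.
rewrite (_ : rV_uncons \o rV_cons = id); last by apply/funext; exact: rV_consK.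
by rewrite preimage_id product_measure1E// lte_mul_pinfty// ge0_fin_numE.
Qed.

HB.instance Definition _ := Measure_isSigmaFinite.Build _ _ _
  lebesgue_rV_step step_sigma_finite.

End lebesgue_rV_step.

Fixpoint lebesgue_rV {R : realType} (d : nat) :
    {sigma_finite_measure set 'rV[R]_d -> \bar R} :=
  match d with
  | 0 => @dirac _ 'rV[R]_0 0 R
  | d'.+1 => lebesgue_rV_step (lebesgue_rV d')
  end.

Arguments lebesgue_rV {R d}.

Section euclidean.
Context {R : realType} {d : nat}.
Implicit Types (x m : 'rV[R]_d) (f : 'rV[R]_d -> R).

(* The library norm `|x| on 'rV[R]_d is the sup norm. *)
Definition sqnorm x : R := \sum_i x ord0 i ^+ 2.

Definition gradient f x : 'rV[R]_d := \row_i 'D_(delta_mx ord0 i) f x.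

(* density at x of N(m, s^2 I), for s > 0 *)
Definition gaussian_pdf m (s : R) x : R :=
  (2 * pi * s ^+ 2) `^ (- (d%:R / 2)) * expR (- sqnorm (x - m) / (2 * s ^+ 2)).

(* Density at x of a *: X0 + s *: eps, where X0 has density p0 and eps is an
   independent standard Gaussian vector; meaningful for s > 0 only. *)
Definition marginal_pdf (p0 : 'rV[R]_d -> R) (a s : R) x : R :=
  \int[lebesgue_rV]_x0 (gaussian_pdf (a *: x0) s x * p0 x0).

(* expectation of f(X) for X with density p *)
Definition expect_pdf (p f : 'rV[R]_d -> R) : \bar R :=
  (\int[lebesgue_rV]_x (f x * p x)%:E)%E.

End euclidean.

Section random_vectors.
Context {dO : measure_display} {Omega : measurableType dO} {R : realType}
  {P : probability Omega R} {d : nat}.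
Implicit Types X Y : {RV P >-> 'rV[R]_d}.

Definition has_density X (p : 'rV[R]_d -> R) : Prop :=
  [/\ measurable_fun setT p, forall x, 0 <= p x &
      forall A, measurable A ->
        distribution P X A = (\int[lebesgue_rV]_(x in A) (p x)%:E)%E].

Definition independent_RV X Y : Prop :=
  forall A B, measurable A -> measurable B ->
    (P (X @^-1` A `&` Y @^-1` B) = P (X @^-1` A) * P (Y @^-1` B))%E.

End random_vectors.

(* f has a finite derivative, relative to A, at every point of A; at an endpoint
   of an interval A this is the one-sided derivative. *)
Definition differentiable_on {R : realType} (A : set R) (f : R -> R) : Prop :=
  forall t, A t -> cvg ((fun s => (f s - f t) / (s - t)) @ within A t^').

Section losses.
Context {R : realType} {d : nat}.
Variables (alpha sigma omega : R -> R).
Implicit Type e : 'rV[R]_d -> R -> 'rV[R]_d.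
Local Open Scope ereal_scope.

Definition score_error (p0 : 'rV[R]_d -> R) e (t : R) : \bar R :=
  let p := marginal_pdf p0 (alpha t) (sigma t) in
  expect_pdf p (fun x =>
    sqnorm (e x t + sigma t *: gradient (fun y => ln (p y)) x)%R).

(* marginal_pdf is not the density of X_t at t = 0, where sigma t = 0; a single
   time is negligible for the integral. *)
Definition score_loss (p0 : 'rV[R]_d -> R) e : \bar R :=
  (2^-1)%:E * \int[lebesgue_measure]_(t in `[0%R, 1%R])
    ((omega t)%:E * score_error p0 e t).

Context {dO : measure_display} {Omega : measurableType dO}
  {P : probability Omega R}.

Definition noise_error (X0 eps : {RV P >-> 'rV[R]_d}) e (t : R) : \bar R :=
  'E_P[fun w => sqnorm (e (alpha t *: X0 w + sigma t *: eps w) t - eps w)%R].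

Definition noise_loss (X0 eps : {RV P >-> 'rV[R]_d}) e : \bar R :=
  (2^-1)%:E * \int[lebesgue_measure]_(t in `[0%R, 1%R])
    ((omega t)%:E * noise_error X0 eps e t).

End losses.

(* Main.v *)
(* Fix t and put X = a X0 + s eps with density p, n = (X - a X0) / s = eps and
   sc = s grad (ln p). Differentiating p under the integral sign shows that sc
   is minus the conditional mean of n given X. For two predictors e and e',
   |e + sc|^2 - |e - n|^2 - |e' + sc|^2 + |e' - n|^2 = 2 <sc + n, e - e'>
   is integrable as soon as the four terms on the left are, and Fubini's theorem
   then shows that its expectation is 0. Hence the difference between the score
   error and the noise error does not depend on the predictor; this is
   integrated over t. Working with two predictors avoids the second moments of
   n and sc. *)
Require Import Defs.
From HB Require Import structures.
From mathcomp Require Import all_boot all_order all_algebra.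
From mathcomp Require Import all_classical all_reals all_analysis.
From mathcomp Require Import measurable_realfun ring lra.

Set Implicit Arguments.
Unset Strict Implicit.
Unset Printing Implicit Defensive.
Import Order.TTheory GRing.Theory Num.Theory.
Import numFieldNormedType.Exports.

Local Open Scope classical_set_scope.
Local Open Scope ring_scope.

(** * Measurability of inverses, vector operations and the Gaussian density *)

(** On nonnegative reals the inverse is the measurable power with exponent -1 (both are 0 at 0), and
    oddness extends this to negative reals. *)
Lemma measurable_fun_inv d (T : measurableType d) {R : realType} (f : T -> R) :
  measurable_fun setT f -> measurable_fun setT (fun w => (f w)^-1).
Proof.
move=> mf; have invE (x : R) :
    x^-1 = if 0 <= x then x `^ (-1) else - ((- x) `^ (-1)).
  case: (lerP 0 x) => x0; first by rewrite powR_inv1.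
  by rewrite powR_inv1 ?invrN ?opprK// oppr_ge0 ltW.
apply: (@measurableT_comp _ _ _ _ _ _ (fun x : R => x^-1)) => //.
under eq_fun do rewrite invE.
apply: measurable_fun_ifT.
- exact: measurable_fun_ler.
- exact: measurable_powR.
- apply: measurableT_comp => //.
  by apply: (measurableT_comp (measurable_powR _)); exact: measurable_funN.
Qed.

Section measurable_rV_operations.
Context d' (T : measurableType d') {R : realType} {d : nat}.
Implicit Types f g : T -> 'rV[R]_d.

Lemma measurable_rV_add f g : measurable_fun setT f -> measurable_fun setT g ->
  measurable_fun setT (fun w => f w + g w).
Proof.
move=> /measurable_fun_rVP mf /measurable_fun_rVP mg.
apply/measurable_fun_rVP => i; under eq_fun do rewrite mxE.
exact: measurable_funD.
Qed.

Lemma measurable_rV_scale (k : T -> R) f :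
  measurable_fun setT k -> measurable_fun setT f ->
  measurable_fun setT (fun w => k w *: f w).
Proof.
move=> mk /measurable_fun_rVP mf.
apply/measurable_fun_rVP => i; under eq_fun do rewrite mxE.
exact: measurable_funM.
Qed.

Lemma measurable_rV_sub f g : measurable_fun setT f -> measurable_fun setT g ->
  measurable_fun setT (fun w => f w - g w).
Proof.
move=> mf mg; under eq_fun do rewrite -scaleN1r.
by apply: measurable_rV_add => //; exact: measurable_rV_scale.
Qed.

Lemma measurable_sqnorm f : measurable_fun setT f ->
  measurable_fun setT (fun w => sqnorm (f w)).
Proof.
move=> /measurable_fun_rVP mf; apply: measurable_sum => i.
exact: measurable_funX.
Qed.

(** Mean, scale and point all vary with the parameter, because the kernel is later integrated
    jointly in position, initial point and time. *)
Lemma measurable_gaussian_pdf (m : T -> 'rV[R]_d) (s : T -> R) f :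
  measurable_fun setT m -> measurable_fun setT s -> measurable_fun setT f ->
  measurable_fun setT (fun w => gaussian_pdf (m w) (s w) (f w)).
Proof.
move=> mm ms mf.
have ms2 : measurable_fun setT (fun w => s w ^+ 2) by exact: measurable_funX.
apply: measurable_funM.
  apply: (measurableT_comp (measurable_powR _)).
  exact: measurable_funM.
apply: measurableT_comp => //; apply: measurable_funM.
  by apply: measurableT_comp => //; apply: measurable_sqnorm;
     exact: measurable_rV_sub.
by apply: measurable_fun_inv; exact: measurable_funM.
Qed.

End measurable_rV_operations.

Lemma sqnorm_ge0 {R : realType} {d : nat} (x : 'rV[R]_d) : 0 <= sqnorm x.
Proof. by apply: sumr_ge0 => i _; exact: sqr_ge0. Qed.

Lemma gaussian_pdf_ge0 {R : realType} {d : nat} (m : 'rV[R]_d) (s : R) x :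
  0 <= gaussian_pdf m s x.
Proof. by rewrite mulr_ge0 ?powR_ge0 ?expR_ge0. Qed.

Lemma gaussian_pdf_gt0 {R : realType} {d : nat} (m : 'rV[R]_d) (s : R) x :
  0 < s -> 0 < gaussian_pdf m s x.
Proof.
move=> s0; rewrite mulr_gt0 ?expR_gt0// powR_gt0// mulr_gt0 ?exprn_gt0//.
by rewrite mulr_gt0 ?pi_gt0.
Qed.

(** * Affine changes of variables for Lebesgue measure *)

(** By uniqueness of Lebesgue measure, it suffices that the rescaled image measure gives each
    interval []a, b]] its length; the preimage of that interval is [](a - m) / s, (b - m) / s]]. *)
Lemma lebesgue_measure_affine {R : realType} (m s : R) (A : set R) :
  0 < s -> measurable A ->
  (s%:E * lebesgue_measure ((fun x : R => (m + s * x)%R) @^-1` A) =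
   lebesgue_measure A)%E.
Proof.
move=> s0 mA.
pose phi : measurableTypeR R -> measurableTypeR R := fun x : R => m + s * x.
have mphi : measurable_fun setT phi.
  by apply: measurable_funD => //; exact: measurable_funM.
pose mu : {measure set (measurableTypeR R) -> \bar R} :=
  mscale (NngNum (ltW s0))
    (measure_function_pushforward__canonical__measure_function_Measure
      (@lebesgue_measure R) mphi).
rewrite -[LHS]/(mu A); apply/esym/lebesgue_measure_unique => //= _ [[a b]] _ <-.
rewrite /mu /mscale/= /pushforward/=.
rewrite (_ : _ @^-1` _ = `](a - m) / s, (b - m) / s]%classic); last first.
  apply/seteqP; split=> x/=; rewrite !in_itv/= ltr_pdivrMr// ler_pdivlMr//;
  by rewrite ltrBlDl lerBrDl (mulrC x).
rewrite !lebesgue_measure_itv/= !lte_fin ltr_pM2r ?invr_gt0// ltrD2r.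
case: ifPn => ab; last by rewrite mule0.
rewrite -!EFinB -EFinM -mulrBl mulrCA divff ?gt_eqF// mulr1.
by congr EFin; ring.
Qed.

Lemma ge0_integral_lebesgue_affine {R : realType} (m s : R) (f : R -> \bar R) :
  0 < s -> measurable_fun setT f -> (forall x, (0 <= f x)%E) ->
  (\int[lebesgue_measure]_x f (m + s * x)%R =
   (s^-1)%:E * \int[lebesgue_measure]_x f x)%E.
Proof.
move=> s0 mf f0.
pose phi : measurableTypeR R -> measurableTypeR R := fun x : R => m + s * x.
have mphi : measurable_fun setT phi.
  by apply: measurable_funD => //; exact: measurable_funM.
have si0 : 0 <= s^-1 by rewrite invr_ge0 ltW.
rewrite -[RHS](ge0_integral_mscale _ _ (NngNum si0))//.
transitivity (\int[pushforward (@lebesgue_measure R) phi]_x f x)%E.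
  by rewrite ge0_integral_pushforward.
apply: eq_measure_integral => //= A mA _.
rewrite /mscale/= /pushforward -(lebesgue_measure_affine m s0 mA) muleA -EFinM.
by rewrite mulVf ?gt_eqF// mul1e.
Qed.

(** Tonelli's theorem after unfolding one step of the recursion that defines [lebesgue_rV]; it
    allows induction on the dimension. *)
Lemma ge0_integral_lebesgue_rV_recl {R : realType} (d : nat)
    (f : 'rV[R]_d.+1 -> \bar R) :
  measurable_fun setT f -> (forall x, (0 <= f x)%E) ->
  (\int[lebesgue_rV]_x f x =
   \int[lebesgue_measure]_r \int[lebesgue_rV]_x f (rV_cons (r, x)))%E.
Proof.
move=> mf f0.
pose T := (measurableTypeR R * 'rV[R]_d)%type.
have mcons : measurable_fun [set: T] (@rV_cons R d : T -> _).
  exact: measurable_rV_cons.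
transitivity (\int[pushforward (@lebesgue_measure R \x @lebesgue_rV R d)
  (@rV_cons R d : T -> _)]_x f x)%E; first by [].
rewrite (ge0_integral_pushforward mcons)//=.
rewrite preimage_setT fubini_tonelli1//.
exact: measurableT_comp mf mcons.
Qed.

(** Induction on [d]: the one-dimensional formula handles the first coordinate and the induction
    hypothesis the others, so that each coordinate contributes one factor [s^-1]. *)
Lemma ge0_integral_lebesgue_rV_affine {R : realType} (d : nat)
    (m : 'rV[R]_d) (s : R) (f : 'rV[R]_d -> \bar R) :
  0 < s -> measurable_fun setT f -> (forall x, (0 <= f x)%E) ->
  (\int[lebesgue_rV]_x f (m + s *: x)%R =
   (s ^- d)%:E * \int[lebesgue_rV]_x f x)%E.
Proof.
move=> s0; elim: d => [|d IHd] in m f * => mf f0.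
  (* In dimension 0 there is only one vector. *)
  rewrite expr0 invr1 mul1e; apply: eq_integral => x _.
  by congr f; apply/rowP => -[].
have maff : measurable_fun setT (fun x : 'rV[R]_d.+1 => m + s *: x).
  by apply: measurable_rV_add => //; exact: measurable_rV_scale.
rewrite !ge0_integral_lebesgue_rV_recl//; last exact: measurableT_comp mf maff.
have mcons r : measurable_fun setT (fun x : 'rV[R]_d => rV_cons (r, x)).
  apply: (measurableT_comp (@measurable_rV_cons R d)).
  exact: measurable_fun_pair.
have mG : measurable_fun setT
    (fun r : R => (\int[lebesgue_rV]_x f (rV_cons (r, x)))%E).
  apply: (@measurable_fun_fubini_tonelli_F _ _ _ _ _ _ (f \o @rV_cons R d)).
    exact: measurableT_comp mf (@measurable_rV_cons R d).
  by move=> x /=.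
transitivity (\int[lebesgue_measure]_r ((s ^- d)%:E *
   \int[lebesgue_rV]_x f (rV_cons ((m ord0 ord0 + s * r)%R, x))))%E.
  apply: eq_integral => r _.
  rewrite -(IHd (\row_j m ord0 (lift ord0 j)))//; last first.
    exact: measurableT_comp mf (mcons _).
  apply: eq_integral => x _; congr f; apply/rowP => i; rewrite !mxE.
  by case: unliftP => [j ->|->] /=; rewrite ?mxE.
have mG' : measurable_fun setT
    (fun r : R =>
      (\int[lebesgue_rV]_x f (rV_cons ((m ord0 ord0 + s * r)%R, x)))%E).
  apply: (measurableT_comp mG).
  by apply: measurable_funD => //; exact: measurable_funM.
have sd0 : (0 <= (s ^- d)%:E)%E by rewrite lee_fin invr_ge0 exprn_ge0 ?ltW.
have G0 r : (0 <= \int[lebesgue_rV]_x f (rV_cons (r, x)))%E.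
  exact: integral_ge0.
rewrite ge0_integralZl//.
rewrite (ge0_integral_lebesgue_affine (m ord0 ord0) s0
  (f := fun r => \int[lebesgue_rV]_x f (rV_cons (r, x)))%E)//.
by rewrite muleA -EFinM exprS invfM mulrC.
Qed.

(** * Integration against a law with a density and against an independent pair *)

Section law_with_density.
Context {dO : measure_display} {Omega : measurableType dO} {R : realType}
  {P : probability Omega R} {d : nat}.
Implicit Types X Y : {RV P >-> 'rV[R]_d}.

(** [has_density] speaks of sets only. It makes the law absolutely continuous, and the Radon-Nikodym
    derivative agrees with [p] almost everywhere because both have the same integral over every
    measurable set. *)
Lemma integral_distribution_density X (p : 'rV[R]_d -> R)
    (f : 'rV[R]_d -> \bar R) :
  has_density X p -> measurable_fun setT f -> (forall x, (0 <= f x)%E) ->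
  (\int[distribution P X]_x f x = \int[lebesgue_rV]_x (f x * (p x)%:E))%E.
Proof.
move=> [mp p0 Xp] mf f0.
have dom : distribution P X `<< @lebesgue_rV R d.
  apply/null_content_dominatesP => A mA A0; rewrite Xp//.
  by apply: null_set_integral => //; exact/measurable_EFinP/measurable_funTS.
rewrite -(Radon_Nikodym_SigmaFinite.change_of_variables dom)//.
have iRN := Radon_Nikodym_SigmaFinite.f_integrable dom.
have mRN := measurable_int _ iRN.
have mpE : measurable_fun setT (EFin \o p) by exact/measurable_EFinP.
apply: ae_eq_integral => //; [exact: emeasurable_funM|exact: emeasurable_funM|].
apply: ae_eqe_mul2l; apply: integral_ae_eq => // A _ mA.
by rewrite -Radon_Nikodym_SigmaFinite.f_integral//; exact: Xp.
Qed.

(** The joint law agrees with the product of the two laws on rectangles, hence everywhere; Tonelli's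
    theorem then splits the integral. *)
Lemma integral_independent_RV X Y (F : 'rV[R]_d * 'rV[R]_d -> \bar R) :
  independent_RV X Y -> measurable_fun setT F -> (forall z, (0 <= F z)%E) ->
  (\int[P]_w F (X w, Y w) =
   \int[distribution P X]_x \int[distribution P Y]_y F (x, y))%E.
Proof.
move=> XY mF F0.
have mXY : measurable_fun setT (fun w => (X w, Y w)).
  exact: measurable_fun_pair.
rewrite -(fubini_tonelli1 F)//.
transitivity (\int[pushforward P (fun w => (X w, Y w))]_z F z)%E.
  by rewrite ge0_integral_pushforward.
apply/esym/eq_measure_integral => A mA _.
by apply: product_measure_unique => // B C mB mC; exact: XY.
Qed.

End law_with_density.

(** * The joint law of the noisy sample and its noise *)

Lemma gaussian_pdf_affine {R : realType} {d : nat} (m : 'rV[R]_d) (s : R) y :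
  0 < s -> gaussian_pdf m s (m + s *: y) = s ^- d * gaussian_pdf 0 1 y.
Proof.
move=> s0; have s20 : 0 < s ^+ 2 by rewrite exprn_gt0.
have sE : (s ^+ 2) `^ (- (d%:R / 2)) = s ^- d.
  rewrite powRN -powR_mulrn ?ltW// -powRrM mulrC divfK//.
  by rewrite powR_mulrn ?ltW.
rewrite /gaussian_pdf expr1n !mulr1 powRM ?ltW ?mulr_gt0 ?pi_gt0// sE.
have -> : - sqnorm (m + s *: y - m) / (2 * s ^+ 2) = - sqnorm (y - 0) / 2.
  rewrite [m + _]addrC addrK subr0 (_ : sqnorm _ = s ^+ 2 * sqnorm y).
    by field; rewrite gt_eqF.
  by rewrite /sqnorm mulr_sumr; apply: eq_bigr => i _; rewrite mxE exprMn.
by rewrite mulrAC mulrC.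
Qed.

Section noisy_law.
Context {dO : measure_display} {Omega : measurableType dO} {R : realType}
  {P : probability Omega R} {d : nat}.
Variables (X0 eps : {RV P >-> 'rV[R]_d}) (p0 : 'rV[R]_d -> R).
Hypothesis X0_density : has_density X0 p0.
Hypothesis eps_gaussian : has_density eps (gaussian_pdf 0 1).
Hypothesis X0_eps_indep : independent_RV X0 eps.

(** For a fixed value x0 of [X0], the substitution x = a x0 + s y turns the standard Gaussian
    density in y into the density of N(a x0, s^2 I) in x, and the noise is recovered as y = (x - a
    x0) / s. On the right, [z] is the pair (x, x0). *)
Lemma integral_noisy (a s : R) (F : 'rV[R]_d * 'rV[R]_d -> \bar R) :
  0 < s -> measurable_fun setT F -> (forall z, (0 <= F z)%E) ->
  (\int[P]_w F (a *: X0 w + s *: eps w, eps w)%R =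
   \int[lebesgue_rV \x lebesgue_rV]_z
     (F (z.1, s^-1 *: (z.1 - a *: z.2))%R *
      (gaussian_pdf (a *: z.2) s z.1 * p0 z.2)%:E))%E.
Proof.
move=> s0 mF F0; have [mp0 p0_ge0 _] := X0_density.
have g0 := @gaussian_pdf_ge0 R d.
pose T := ('rV[R]_d * 'rV[R]_d)%type.
have mn : measurable_fun [set: T]
    (fun z : T => (z.1, s^-1 *: (z.1 - a *: z.2))).
  apply: measurable_fun_pair => //; apply: measurable_rV_scale => //.
  by apply: measurable_rV_sub => //; exact: measurable_rV_scale.
have mg : measurable_fun [set: T] (fun z : T => gaussian_pdf (a *: z.2) s z.1).
  by apply: measurable_gaussian_pdf => //; exact: measurable_rV_scale.
have mFn := measurableT_comp mF mn.
have mswap : measurable_fun [set: T] (fun z : T => (a *: z.1 + s *: z.2, z.2)).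
  apply: measurable_fun_pair => //.
  by apply: measurable_rV_add => //; exact: measurable_rV_scale.
pose F' (z : T) := F (a *: z.1 + s *: z.2, z.2).
have mF' : measurable_fun [set: T] F' by exact: measurableT_comp mF mswap.
rewrite (integral_independent_RV (F := F') X0_eps_indep)//; last first.
  by move=> z; exact: F0.
rewrite (integral_distribution_density X0_density)//; last 2 first.
- apply: (@measurable_fun_fubini_tonelli_F _ _ _ _ _
    (distribution P eps) F') => //.
  by move=> z; exact: F0.
- by move=> x; apply: integral_ge0 => y _; exact: F0.
(* The order with x0 outermost is chosen, so that the substitution takes place at fixed x0. *)
rewrite fubini_tonelli2; last 2 first.
- apply: emeasurable_funM => //; apply/measurable_EFinP.
  apply: measurable_funM => //; exact: measurableT_comp.
- by move=> z; rewrite mule_ge0// lee_fin mulr_ge0.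
apply: eq_integral => x0 _; rewrite /fubini_G/=.
have mpair : measurable_fun setT (fun x : 'rV[R]_d => (x, x0)).
  exact: measurable_fun_pair.
pose G (x : 'rV[R]_d) :=
  (F (x, s^-1 *: (x - a *: x0))%R * (gaussian_pdf (a *: x0) s x)%:E)%E.
have mG : measurable_fun setT G.
  apply: emeasurable_funM; first exact: (measurableT_comp mFn mpair).
  by apply/measurable_EFinP; exact: (measurableT_comp mg mpair).
have G0 x : (0 <= G x)%E by rewrite mule_ge0// lee_fin.
transitivity (\int[lebesgue_rV]_x (G x * (p0 x0)%:E))%E; last first.
  by apply: eq_integral => x _; rewrite /G -muleA -EFinM.
rewrite ge0_integralZr ?lee_fin//; congr (_ * _)%E.
rewrite (integral_distribution_density eps_gaussian)//; last 2 first.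
- apply: (measurableT_comp mF').
  exact: measurable_fun_pair.
- by move=> y; exact: F0.
have sd0 : 0 < s ^+ d by rewrite exprn_gt0.
(* The factor [s ^+ d] undoes the [s ^- d] of [gaussian_pdf_affine]; it cancels against the Jacobian
   of the substitution. *)
transitivity (\int[lebesgue_rV]_y ((s ^+ d)%:E * G (a *: x0 + s *: y)%R))%E.
  apply: eq_integral => y _; rewrite /G gaussian_pdf_affine// /F'/=.
  rewrite [a *: x0 + _]addrC addrK scalerA mulVf ?gt_eqF// scale1r addrC.
  by rewrite muleCA -EFinM mulVKf ?gt_eqF.
rewrite ge0_integralZl ?lee_fin ?ltW//; last first.
  apply: (measurableT_comp mG).
  by apply: measurable_rV_add => //; exact: measurable_rV_scale.
rewrite ge0_integral_lebesgue_rV_affine// muleA -EFinM mulfV ?gt_eqF//.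
by rewrite mul1e.
Qed.

End noisy_law.

(** * Coordinate derivatives of the Gaussian density, with uniform bounds *)

(** Turns a gradient entry into the derivative at 0 of a function of one real variable, to which the
    chain rule and differentiation under the integral sign apply. *)
Lemma derive_along_line {R : numFieldType} {V W : normedModType R} (f : V -> W)
    (x v : V) : 'D_v f x = (fun h : R => f (h *: v + x))^`()%classic 0.
Proof.
rewrite /derive /derive1 /=.
have -> : (fun h : R => h^-1 *: (f ((h + 0) *: v + x) - f (0 *: v + x))) =
          (fun h : R => h^-1 *: (f (h *: v + x) - f x)).
  by apply/funext => h; rewrite addr0 scale0r add0r.
by [].
Qed.

Section gaussian_derivative.
Context {R : realType} {d : nat}.
Implicit Types (m x : 'rV[R]_d) (s : R) (i : 'I_d).

Lemma sqr_coord_le_sqnorm x i : x ord0 i ^+ 2 <= sqnorm x.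
Proof.
rewrite /sqnorm (bigD1 i)//= lerDl; apply: sumr_ge0 => j _; exact: sqr_ge0.
Qed.

Lemma gaussian_pdf_le m s x :
  gaussian_pdf m s x <= (2 * pi * s ^+ 2) `^ (- (d%:R / 2)).
Proof.
rewrite ler_piMr ?powR_ge0// -expR0 ler_expR mulNr oppr_le0.
by rewrite divr_ge0 ?sqnorm_ge0// mulr_ge0// sqr_ge0.
Qed.

(** With u = |x_i - m_i| / s one has u <= 1 + u^2 / 2 <= exp(u^2 / 2), so the exponential of the
    density absorbs the linear factor. The bound is uniform in [x] and [m], as a domination argument
    requires. *)
Lemma gaussian_score_le m s x i : 0 < s ->
  `|(x - m) ord0 i / s * gaussian_pdf m s x| <=
  (2 * pi * s ^+ 2) `^ (- (d%:R / 2)).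
Proof.
move=> s0; rewrite normrM (ger0_norm (gaussian_pdf_ge0 m s x)).
rewrite /gaussian_pdf mulrCA. rewrite ler_piMr ?powR_ge0//.
rewrite mulNr expRN -ler_pdivlMr ?invr_gt0 ?expR_gt0// invrK mul1r.
rewrite normrM normfV (gtr0_norm s0).
set u := `|_| / s.
have s2 : 0 < 2 * s ^+ 2 by rewrite mulr_gt0 ?exprn_gt0.
apply: (@le_trans _ _ (1 + u ^+ 2 / 2)).
  by rewrite -subr_ge0; nra.
apply: le_trans (expR_ge1Dx _) _; rewrite ler_expR.
rewrite ler_pdivlMr// /u expr_div_n real_normK ?num_real//.
apply: le_trans (sqr_coord_le_sqnorm (x - m) i).
rewrite le_eqVlt; apply/orP; left; apply/eqP; by field; rewrite gt_eqF.
Qed.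

Lemma is_derive_gaussian_pdf m s x i (h : R) : 0 < s ->
  is_derive h 1 (fun r : R => gaussian_pdf m s (r *: delta_mx ord0 i + x))
    (- ((h *: delta_mx ord0 i + x - m) ord0 i / s ^+ 2 *
        gaussian_pdf m s (h *: delta_mx ord0 i + x))).
Proof.
move=> s0; set K := (2 * pi * s ^+ 2) `^ (- (d%:R / 2)).
set b := (x - m) ord0 i; set c := sqnorm (x - m).
(* Only the [i]-th term of the squared norm varies along the line, so the exponent is a quadratic
   polynomial in [r]. *)
have sE r : sqnorm (r *: delta_mx ord0 i + x - m) = c + 2 * r * b + r ^+ 2.
  rewrite /c /b /sqnorm -addrA [in LHS](bigD1 i)//= [in RHS](bigD1 i)//=.
  rewrite !mxE !eqxx mulr1 (eq_bigr (fun j => (x - m) ord0 j ^+ 2)).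
    ring.
  by move=> j ji; rewrite !mxE eqxx (negbTE ji) mulr0 add0r.
rewrite (_ : (fun _ => _) = fun r : R =>
    K * expR (- (c + 2 * r * b + r ^+ 2) / (2 * s ^+ 2))); last first.
  by apply/funext => r; rewrite /gaussian_pdf sE.
rewrite (_ : (_ - m) ord0 i = h + b); last first.
  by rewrite /b !mxE !eqxx mulr1 addrA.
apply: is_derive_eq; rewrite /gaussian_pdf sE -/K.
rewrite /GRing.scale/=; set E := expR _.
by field; rewrite gt_eqF.
Qed.

End gaussian_derivative.

(** * The marginal density and its score at fixed coefficients *)

Section marginal.
Context {R : realType} {d : nat}.
Variables (p0 : 'rV[R]_d -> R) (a s : R).
Hypothesis mp0 : measurable_fun setT p0.
Hypothesis p0_ge0 : forall x, 0 <= p0 x.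
Hypothesis p0_int : (\int[lebesgue_rV]_x (p0 x)%:E = 1)%E.
Hypothesis s_gt0 : 0 < s.
Implicit Types x y : 'rV[R]_d.

Let K := (2 * pi * s ^+ 2) `^ (- (d%:R / 2)).

Let g_ge0 y x : 0 <= gaussian_pdf (a *: y) s x.
Proof. exact: gaussian_pdf_ge0. Qed.

Lemma integrable_density : lebesgue_rV.-integrable setT (EFin \o p0).
Proof.
apply/integrableP; split; first exact/measurable_EFinP.
under eq_integral do rewrite /= ger0_norm//.
by rewrite p0_int ltry.
Qed.

Lemma integrable_bounded_density (k : 'rV[R]_d -> R) (C : R) :
  measurable_fun setT k -> (forall y, `|k y| <= C) ->
  lebesgue_rV.-integrable setT (EFin \o (fun y => k y * p0 y)).
Proof.
move=> mk kC; have C0 : 0 <= C by exact: le_trans (kC 0).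
have iC : lebesgue_rV.-integrable setT (fun y => (C%:E * (p0 y)%:E)%E).
  exact: integrableZl integrable_density.
apply: le_integrable iC => //.
  by apply/measurable_EFinP; exact: measurable_funM.
move=> y _ /=; rewrite lee_fin !normrM (ger0_norm (p0_ge0 y)).
by rewrite ler_wpM2r// (ger0_norm C0).
Qed.

Let mg x : measurable_fun setT (fun y => gaussian_pdf (a *: y) s x).
Proof. by apply: measurable_gaussian_pdf => //; exact: measurable_rV_scale. Qed.

Let mn x i : measurable_fun setT (fun y => (x - a *: y) ord0 i).
Proof.
move: i; apply/measurable_fun_rVP.
by apply: measurable_rV_sub => //; exact: measurable_rV_scale.
Qed.

Lemma integrable_marginal x :
  lebesgue_rV.-integrable setT
    (EFin \o (fun y => gaussian_pdf (a *: y) s x * p0 y)).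
Proof.
apply: (@integrable_bounded_density _ K) => // y.
by rewrite ger0_norm// gaussian_pdf_le.
Qed.

Lemma integrable_noise_marginal x i :
  lebesgue_rV.-integrable setT (EFin \o (fun y =>
    (x - a *: y) ord0 i / s * gaussian_pdf (a *: y) s x * p0 y)).
Proof.
apply: (@integrable_bounded_density _ K) => [|y]; last exact: gaussian_score_le.
by apply: measurable_funM => //; exact: measurable_funM.
Qed.

(** A real-valued integral is the finite part of an extended one, and an infinite value would be
    sent to 0; integrability rules this out. *)
Lemma EFin_marginal_pdf x : ((marginal_pdf p0 a s x)%:E =
  \int[lebesgue_rV]_y (gaussian_pdf (a *: y) s x * p0 y)%:E)%E.
Proof.
by rewrite fineK//; apply: integrable_fin_num => //; exact: integrable_marginal.
Qed.

(** If the integral vanished, so would its nonnegative integrand almost everywhere; the Gaussian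
    factor is positive, so [p0] would be 0 almost everywhere, against its total mass 1. Positivity
    makes the logarithm differentiable at this value. *)
Lemma marginal_pdf_gt0 x : 0 < marginal_pdf p0 a s x.
Proof.
rewrite lt_neqAle; apply/andP; split; last first.
  by apply: Rintegral_ge0 => y _; rewrite mulr_ge0.
apply/negP => /eqP/esym p_eq0; have := EFin_marginal_pdf x.
rewrite p_eq0 => /esym wt0.
have mw := measurable_int _ (integrable_marginal x).
have ae0 : ae_eq lebesgue_rV setT (EFin \o p0) (cst 0%E).
  have wt_ae0 := (ae_eq_integral_abs lebesgue_rV measurableT mw).1.
  have : ae_eq lebesgue_rV setT
      (EFin \o (fun y => gaussian_pdf (a *: y) s x * p0 y)) (cst 0%E).
    apply/wt_ae0; rewrite -[RHS]wt0; apply: eq_integral => y _ /=.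
    by rewrite ger0_norm// mulr_ge0.
  apply: filterS => y /= /(_ I) [] /eqP; rewrite mulf_eq0 => /orP[|/eqP->//].
  by rewrite gt_eqF// gaussian_pdf_gt0.
have := p0_int; rewrite (ae_eq_integral (cst 0%E))//.
  by rewrite integral0 => /eqP; rewrite eq_sym onee_eq0.
exact/measurable_EFinP.
Qed.

Lemma is_derive_marginal_pdf x i :
  is_derive (0 : R) 1
    (fun h : R => marginal_pdf p0 a s (h *: delta_mx ord0 i + x))
    (- (s^-1 * \int[lebesgue_rV]_y
       ((x - a *: y) ord0 i / s * gaussian_pdf (a *: y) s x * p0 y))).
Proof.
pose f h y := gaussian_pdf (a *: y) s (h *: delta_mx ord0 i + x) * p0 y.
have df (h : R) y : is_derive h 1 (f ^~ y)
    (- ((h *: delta_mx ord0 i + x - a *: y) ord0 i / s ^+ 2 *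
        gaussian_pdf (a *: y) s (h *: delta_mx ord0 i + x)) * p0 y).
  have dg := is_derive_gaussian_pdf (a *: y) x i h s_gt0.
  rewrite /f; apply: is_derive_eq.
  by rewrite scaler0 add0r /GRing.scale/= mulrC.
(* Any open interval around 0 would do, since the bound on the derivative is uniform in [h]. *)
have I0 : `]-1, 1[%classic (0 : R) by rewrite /= in_itv/= ltrN10 ltr01.
(* The dominating function: [gaussian_score_le] bounds the kernel's derivative by [K] times the
   [s^-1] left over from 1 / s^2. *)
pose G y := s^-1 * K * p0 y.
have G0 y : 0 <= G y by rewrite !mulr_ge0 ?powR_ge0// invr_ge0 ltW.
have iG : lebesgue_rV.-integrable setT (EFin \o G).
  have := integrableZl measurableT (s^-1 * K) integrable_density.
  by apply: eq_integrable => // y _; rewrite /= EFinM.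
have fG (h : R) y : `]-1, 1[%classic h -> setT y -> `|partial1of2 f h y| <= G y.
  move=> _ _; rewrite partial1of2E (@derive_val _ _ _ _ _ _ _ (df h y)).
  rewrite normrM (ger0_norm (p0_ge0 y)) ler_wpM2r// normrN.
  set n := _ ord0 i; set g := gaussian_pdf _ _ _.
  have -> : n / s ^+ 2 * g = s^-1 * (n / s * g) by field; rewrite gt_eqF.
  rewrite normrM (gtr0_norm (_ : 0 < s^-1)) ?invr_gt0//.
  rewrite ler_wpM2l ?invr_ge0 ?(ltW s_gt0)//.
  exact: gaussian_score_le.
have intf (h : R) : `]-1, 1[%classic h ->
    lebesgue_rV.-integrable setT (EFin \o f h).
  by move=> _; exact: integrable_marginal.
have derf (h : R) y : `]-1, 1[%classic h -> setT y -> derivable (f ^~ y) h 1.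
  by move=> _ _; exact: ex_derive.
apply: DeriveDef.
  exact: (derivable_under_integral measurableT I0 intf derf G0 iG fG).
rewrite -derive1E.
rewrite [LHS](differentiation_under_integral measurableT I0 intf derf G0 iG fG).
rewrite -mulNr -RintegralZl//; last exact: integrable_noise_marginal.
apply: eq_Rintegral => y _.
rewrite partial1of2E (@derive_val _ _ _ _ _ _ _ (df 0 y)) scale0r add0r.
by field; rewrite gt_eqF.
Qed.

(** A form of Tweedie's formula: the quotient on the right is minus the conditional mean of the
    [i]-th noise coordinate given X = [x]. The factor [s] cancels the [s^-1] in the derivative of
    the marginal. *)
Lemma gradient_ln_marginal_pdf x i :
  s * gradient (fun y => ln (marginal_pdf p0 a s y)) x ord0 i =
  - (\int[lebesgue_rV]_y
      ((x - a *: y) ord0 i / s * gaussian_pdf (a *: y) s x * p0 y))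
  / marginal_pdf p0 a s x.
Proof.
set J := Rintegral _ _ _.
rewrite mxE.
pose q (h : R) := marginal_pdf p0 a s (h *: delta_mx ord0 i + x).
have q0 : q 0 = marginal_pdf p0 a s x by rewrite /q scale0r add0r.
have dq : is_derive (0 : R) 1 q (- (s^-1 * J)) := is_derive_marginal_pdf x i.
have dln : is_derive (q 0) 1 (@ln R) (q 0)^-1.
  by apply: is_derive1_ln; rewrite q0 marginal_pdf_gt0.
have dlq := is_derive1_comp dln dq.
have -> : 'D_(delta_mx ord0 i) (fun y => ln (marginal_pdf p0 a s y)) x =
    (@ln R \o q)^`()%classic 0.
  by rewrite derive_along_line.
rewrite derive1E (@derive_val _ _ _ _ _ _ _ dlq) q0.
by field; rewrite !gt_eqF ?marginal_pdf_gt0.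
Qed.

(* The conditional mean of the noise given [X = x] is minus the scaled score. *)
Lemma score_noise_orthogonal x (u : 'rV[R]_d) :
  (\int[lebesgue_rV]_y ((\sum_i
     (s *: gradient (fun y => ln (marginal_pdf p0 a s y)) x +
      s^-1 *: (x - a *: y)) ord0 i * u ord0 i) *
     (gaussian_pdf (a *: y) s x * p0 y))%:E = 0)%E.
Proof.
set sc := s *: _; set w := fun y => gaussian_pdf (a *: y) s x * p0 y.
pose n i y := (x - a *: y) ord0 i / s * gaussian_pdf (a *: y) s x * p0 y.
have iw : lebesgue_rV.-integrable setT (EFin \o w) := integrable_marginal x.
have inw i : lebesgue_rV.-integrable setT (EFin \o n i).
  exact: integrable_noise_marginal.
pose h i y := ((sc ord0 i * u ord0 i)%:E * (w y)%:E +
               (u ord0 i)%:E * (n i y)%:E)%E.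
have i1 i : lebesgue_rV.-integrable setT
    (fun y => (sc ord0 i * u ord0 i)%:E * (w y)%:E)%E.
  exact: (integrableZl measurableT _ iw).
have i2 i : lebesgue_rV.-integrable setT
    (fun y => (u ord0 i)%:E * (n i y)%:E)%E.
  exact: (integrableZl measurableT _ (inw i)).
transitivity (\int[lebesgue_rV]_y (\sum_i h i y))%E.
  apply: eq_integral => y _; rewrite mulr_suml -sumEFin; apply: eq_bigr => i _.
  rewrite /h /n /w -!EFinM -EFinD; congr EFin; rewrite !mxE.
  by field; rewrite gt_eqF.
rewrite integral_sum//; last by move=> i; exact: integrableD.
apply: big1 => i _.
rewrite integralD// !integralZl//; last exact: inw.
have -> : (\int[lebesgue_rV]_y (w y)%:E = (marginal_pdf p0 a s x)%:E)%E.
  exact/esym/EFin_marginal_pdf.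
have -> : (\int[lebesgue_rV]_y (n i y)%:E = (\int[lebesgue_rV]_y n i y)%:E)%E.
  by rewrite fineK//; exact: (integrable_fin_num measurableT (inw i)).
(* In coordinate [i] the score part integrates to sc_i u_i p(x) and the noise part to u_i times the
   integral of [n i]; they are opposite by Tweedie's formula. *)
rewrite -!EFinM -EFinD [sc ord0 i]mxE gradient_ln_marginal_pdf; congr EFin.
by field; rewrite gt_eqF ?marginal_pdf_gt0.
Qed.

End marginal.

(** * Measurability of the marginal density and of the score in all parameters *)

Section marginal_measurability.
Context d' (T : measurableType d') {R : realType} {d : nat}.
Variables (p0 : 'rV[R]_d -> R) (a s : T -> R) (f : T -> 'rV[R]_d).
Hypothesis mp0 : measurable_fun setT p0.
Hypothesis p0_ge0 : forall x, 0 <= p0 x.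
Hypothesis p0_int : (\int[lebesgue_rV]_x (p0 x)%:E = 1)%E.
Hypothesis ma : measurable_fun setT a.
Hypothesis ms : measurable_fun setT s.
Hypothesis s_gt0 : forall w, 0 < s w.
Hypothesis mf : measurable_fun setT f.

Let mkernel : measurable_fun [set: T * 'rV[R]_d]
  (fun z => gaussian_pdf (a z.1 *: z.2) (s z.1) (f z.1) * p0 z.2).
Proof.
apply: measurable_funM; last exact: measurableT_comp.
apply: measurable_gaussian_pdf; try exact: measurableT_comp.
by apply: measurable_rV_scale => //; exact: measurableT_comp.
Qed.

Lemma measurable_marginal_pdf :
  measurable_fun setT (fun w => marginal_pdf p0 (a w) (s w) (f w)).
Proof.
apply: (measurableT_comp (fine_measurable measurableT)).
apply: (@measurable_fun_fubini_tonelli_F _ _ T 'rV[R]_d R lebesgue_rV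
  (fun z => (gaussian_pdf (a z.1 *: z.2) (s z.1) (f z.1) * p0 z.2)%:E)).
  exact/measurable_EFinP.
by move=> z; rewrite lee_fin mulr_ge0 ?gaussian_pdf_ge0.
Qed.

(** The gradient is defined by limits; [gradient_ln_marginal_pdf] replaces it by a quotient of
    parametric integrals, whose measurability comes from Tonelli's theorem. *)
Lemma measurable_gradient_ln_marginal_pdf : measurable_fun setT
  (fun w => gradient (fun y => ln (marginal_pdf p0 (a w) (s w) y)) (f w)).
Proof.
apply/measurable_fun_rVP => i.
pose J z := (f z.1 - a z.1 *: z.2) ord0 i / s z.1 *
  gaussian_pdf (a z.1 *: z.2) (s z.1) (f z.1) * p0 z.2.
have mJ : measurable_fun [set: T * 'rV[R]_d] (EFin \o J).
  apply/measurable_EFinP; rewrite /J; under eq_fun do rewrite -mulrA.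
  apply: measurable_funM => //; apply: measurable_funM.
    move: i {J}; apply/measurable_fun_rVP; apply: measurable_rV_sub.
      exact: measurableT_comp.
    by apply: measurable_rV_scale => //; exact: measurableT_comp.
  by apply: measurable_fun_inv; exact: measurableT_comp.
rewrite (_ : (fun _ => _) = fun w => (s w)^-1 *
    (- fine (\int[lebesgue_rV]_y (EFin \o J) (w, y))%E /
     marginal_pdf p0 (a w) (s w) (f w))); last first.
  apply/funext => w; apply: (mulfI (lt0r_neq0 (s_gt0 w))).
  rewrite mulVKf ?gt_eqF//.
  exact: (gradient_ln_marginal_pdf (a w) mp0 p0_ge0 p0_int (s_gt0 w)).
apply: measurable_funM; first exact: measurable_fun_inv.
apply: measurable_funM; last exact/measurable_fun_inv/measurable_marginal_pdf.
apply: measurable_funN; apply: (measurableT_comp (fine_measurable measurableT)).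
(* [J] has no constant sign, so its positive and negative parts are treated separately. *)
rewrite (_ : (fun _ => _) = fun w =>
    (\int[lebesgue_rV]_y (EFin \o J)^\+ (w, y) -
     \int[lebesgue_rV]_y (EFin \o J)^\- (w, y))%E); last first.
  apply/funext => w; rewrite [LHS]integralE.
  by congr (_ - _)%E; apply: eq_integral => y _; rewrite ?funeposE ?funenegE.
apply: emeasurable_funB.
- apply: (@measurable_fun_fubini_tonelli_F _ _ T 'rV[R]_d R lebesgue_rV
    ((EFin \o J)^\+)%E); [exact: measurable_funepos|exact: funepos_ge0].
- apply: (@measurable_fun_fubini_tonelli_F _ _ T 'rV[R]_d R lebesgue_rV
    ((EFin \o J)^\-)%E); [exact: measurable_funeneg|exact: funeneg_ge0].
Qed.

End marginal_measurability.

Lemma has_density_int {dO : measure_display} {Omega : measurableType dO}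
    {R : realType} {P : probability Omega R} {d : nat}
    (X : {RV P >-> 'rV[R]_d}) (p : 'rV[R]_d -> R) :
  has_density X p -> (\int[lebesgue_rV]_x (p x)%:E = 1)%E.
Proof. by move=> [_ _ <-//]; exact: probability_setT. Qed.

(** * Score error against noise error at a fixed time *)

Section score_matching.
Context {dO : measure_display} {Omega : measurableType dO} {R : realType}
  {P : probability Omega R} {d : nat}.
Variables (X0 eps : {RV P >-> 'rV[R]_d}) (p0 : 'rV[R]_d -> R).
Hypothesis X0_density : has_density X0 p0.
Hypothesis eps_gaussian : has_density eps (gaussian_pdf 0 1).
Hypothesis X0_eps_indep : independent_RV X0 eps.
Variables (alpha sigma : R -> R) (t : R).
Hypothesis sigma_gt0 : 0 < sigma t.
Implicit Types e : 'rV[R]_d -> R -> 'rV[R]_d.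

Let a := alpha t.
Let s := sigma t.
Let s_gt0 : 0 < s. Proof. exact: sigma_gt0. Qed.
Let mp0 : measurable_fun setT p0. Proof. by have [] := X0_density. Qed.
Let p0_ge0 x : 0 <= p0 x. Proof. by have [] := X0_density. Qed.
Let p0_int := has_density_int X0_density.
Let T := ('rV[R]_d * 'rV[R]_d)%type.
(** The joint density of (X_t, X_0) at [z]; the function [n] below is the noise expressed through
    this pair. *)
Let w (z : T) := gaussian_pdf (a *: z.2) s z.1 * p0 z.2.
Let n (z : T) := s^-1 *: (z.1 - a *: z.2).
Let p := marginal_pdf p0 a s.
Let sc x := s *: gradient (fun y => ln (p y)) x.

Let w_ge0 z : 0 <= w z.
Proof. by rewrite mulr_ge0 ?gaussian_pdf_ge0. Qed.

Let mw : measurable_fun [set: T] w.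
Proof.
apply: measurable_funM; last exact: measurableT_comp.
by apply: measurable_gaussian_pdf => //; exact: measurable_rV_scale.
Qed.

Let mn : measurable_fun [set: T] n.
Proof.
apply: measurable_rV_scale => //.
by apply: measurable_rV_sub => //; exact: measurable_rV_scale.
Qed.

Let msc : measurable_fun setT sc.
Proof.
apply: measurable_rV_scale => //.
exact: (measurable_gradient_ln_marginal_pdf (a := cst a) (s := cst s)).
Qed.

(** Since [p] is the integral of [w] over its second variable, Tonelli's theorem brings the score
    error to the product space on which the noise error also lives. *)
Let expect_marginal_pdf (f : 'rV[R]_d -> R) :
  measurable_fun setT f -> (forall x, 0 <= f x) ->
  (expect_pdf p f =
   \int[lebesgue_rV \x lebesgue_rV]_z (f z.1 * w z)%:E)%E.
Proof.
move=> mf f0; rewrite fubini_tonelli1; last 2 first.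
- apply/measurable_EFinP; apply: measurable_funM => //.
  exact: measurableT_comp.
- by move=> z; rewrite lee_fin mulr_ge0.
have mpair x : measurable_fun [set: 'rV[R]_d] (fun y : 'rV[R]_d => (x, y) : T).
  exact: measurable_fun_pair.
apply: eq_integral => x _; rewrite /fubini_F/= EFinM.
rewrite (EFin_marginal_pdf a s mp0 p0_ge0 p0_int) -ge0_integralZl ?lee_fin//.
- by apply/measurable_EFinP; exact: (measurableT_comp mw (mpair x)).
- by move=> y _; rewrite lee_fin (w_ge0 (x, y)).
Qed.

Let score_errorE e : measurable_fun setT (e ^~ t) ->
  score_error alpha sigma p0 e t =
  (\int[lebesgue_rV \x lebesgue_rV]_z (sqnorm (e z.1 t + sc z.1) * w z)%:E)%E.
Proof.
move=> me; apply: (expect_marginal_pdf (f := fun x => sqnorm (e x t + sc x))).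
  by apply: measurable_sqnorm; exact: measurable_rV_add.
by move=> x; exact: sqnorm_ge0.
Qed.

Let noise_errorE e : measurable_fun setT (e ^~ t) ->
  noise_error alpha sigma X0 eps e t =
  (\int[lebesgue_rV \x lebesgue_rV]_z (sqnorm (e z.1 t - n z) * w z)%:E)%E.
Proof.
move=> me; rewrite /noise_error unlock.
pose F (z : T) := (sqnorm (e z.1 t - z.2))%:E.
have mF : measurable_fun [set: T] F.
  apply/measurable_EFinP/measurable_sqnorm/measurable_rV_sub => //.
  exact: (measurableT_comp me measurable_fst).
have F0 z : (0 <= F z)%E by rewrite lee_fin sqnorm_ge0.
rewrite [LHS](integral_noisy X0_density eps_gaussian X0_eps_indep a s_gt0 mF
  F0).
by apply: eq_integral => z _; rewrite EFinM.
Qed.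

(** The identity is stated with sums rather than differences: all terms are nonnegative, so it can
    be weighted and integrated over time by additivity alone. *)
Lemma score_noise_exchange e e' :
  measurable_fun setT (e ^~ t) -> measurable_fun setT (e' ^~ t) ->
  score_error alpha sigma p0 e t \is a fin_num ->
  score_error alpha sigma p0 e' t \is a fin_num ->
  noise_error alpha sigma X0 eps e t \is a fin_num ->
  noise_error alpha sigma X0 eps e' t \is a fin_num ->
  (score_error alpha sigma p0 e t + noise_error alpha sigma X0 eps e' t =
   noise_error alpha sigma X0 eps e t + score_error alpha sigma p0 e' t)%E.
Proof.
move=> me me'; rewrite !score_errorE// !noise_errorE//.
move=> Se Se' Ne Ne'.
have me1 : measurable_fun [set: T] (fun z : T => e z.1 t).
  exact: (measurableT_comp me measurable_fst).
have me'1 : measurable_fun [set: T] (fun z : T => e' z.1 t).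
  exact: (measurableT_comp me' measurable_fst).
have msc1 : measurable_fun [set: T] (sc \o fst).
  exact: (measurableT_comp msc measurable_fst).
(* For nonnegative integrands, a finite integral means integrability, which Fubini's theorem for the
   signed [h] needs. *)
have integrable_sqnorm (g : T -> 'rV[R]_d) : measurable_fun setT g ->
    (\int[lebesgue_rV \x lebesgue_rV]_z (sqnorm (g z) * w z)%:E)%E
      \is a fin_num ->
    (lebesgue_rV \x lebesgue_rV)%E.-integrable setT
      (fun z => (sqnorm (g z) * w z)%:E).
  move=> mg g_fin; apply/integrableP; split.
    apply/measurable_EFinP; apply: measurable_funM => //.
    exact: measurable_sqnorm.
  have gw0 z : (0 <= (sqnorm (g z) * w z)%:E)%E.
    by rewrite lee_fin mulr_ge0 ?sqnorm_ge0.
  rewrite (eq_integral (fun z => (sqnorm (g z) * w z)%:E)); last first.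
    by move=> z _; rewrite gee0_abs.
  rewrite -ge0_fin_numE//; exact: integral_ge0.
have iSe := integrable_sqnorm _ (measurable_rV_add me1 msc1) Se.
have iSe' := integrable_sqnorm _ (measurable_rV_add me'1 msc1) Se'.
have iNe := integrable_sqnorm _ (measurable_rV_sub me1 mn) Ne.
have iNe' := integrable_sqnorm _ (measurable_rV_sub me'1 mn) Ne'.
pose h z := ((sqnorm (e z.1 t + sc z.1) * w z)%:E +
             (sqnorm (e' z.1 t - n z) * w z)%:E -
             ((sqnorm (e z.1 t - n z) * w z)%:E +
              (sqnorm (e' z.1 t + sc z.1) * w z)%:E))%E.
have ih : (lebesgue_rV \x lebesgue_rV)%E.-integrable setT h.
  by apply: integrableB => //; exact: integrableD.
have h0 : (\int[lebesgue_rV \x lebesgue_rV]_z h z = 0)%E.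
  (* At fixed x the squares cancel and [h] is the weight times the inner product of sc + n with 2 (e
     - e'). The latter vector does not depend on y, so orthogonality makes the inner integral 0. *)
  rewrite -integral12_prod_meas1//; apply: integral0_eq => x _.
  rewrite -[RHS](score_noise_orthogonal a mp0 p0_ge0 p0_int s_gt0 x
    (2 *: (e x t - e' x t))).
  apply: eq_integral => y _; rewrite /h/= -!EFinD; congr EFin.
  rewrite -!mulrDl -mulrBl; congr (_ * _).
  rewrite /sqnorm -!big_split/= -sumrB; apply: eq_bigr => i _.
  by rewrite !mxE; ring.
have subr0_eqe (x y : \bar R) : y \is a fin_num -> (x - y = 0 -> x = y)%E.
  by move=> y_fin xy; rewrite -(subeK x y_fin) xy add0e.
apply: subr0_eqe; first by rewrite fin_numD Ne Se'.
rewrite -h0 [RHS]integralB//; [|exact: integrableD..].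
by rewrite (integralD _ iSe iNe')// (integralD _ iNe iSe').
Qed.

End score_matching.

(** * Measurability of the two errors in time *)

Section error_measurability.
Context {dO : measure_display} {Omega : measurableType dO} {R : realType}
  {P : probability Omega R} {d : nat}.
Variables (X0 eps : {RV P >-> 'rV[R]_d}) (p0 : 'rV[R]_d -> R).
Hypothesis X0_density : has_density X0 p0.
Variables (alpha sigma : R -> R) (e : 'rV[R]_d -> R -> 'rV[R]_d).
Hypothesis malpha : measurable_fun setT alpha.
Hypothesis msigma : measurable_fun setT sigma.
Hypothesis me : measurable_fun setT (fun z : 'rV[R]_d * R => e z.1 z.2).

Let me_comp d' (T : measurableType d') (f : T -> 'rV[R]_d) (t : T -> R) :
  measurable_fun setT f -> measurable_fun setT t ->
  measurable_fun setT (fun w => e (f w) (t w)).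
Proof.
move=> mf mt.
have mft : measurable_fun setT (fun w => (f w, t w)).
  exact: measurable_fun_pair.
exact: (measurableT_comp me mft).
Qed.

(** Positivity of [sigma] is asked at all times because the formula for the score divides by it. *)
Lemma measurable_score_error : (forall t, 0 < sigma t) ->
  measurable_fun setT (score_error alpha sigma p0 e).
Proof.
move=> sigma_gt0; have [mp0 p0_ge0 _] := X0_density.
have p0_int := has_density_int X0_density.
pose T := (R * 'rV[R]_d)%type.
have ma1 : measurable_fun [set: T] (fun z => alpha z.1).
  exact: (measurableT_comp malpha measurable_fst).
have ms1 : measurable_fun [set: T] (fun z => sigma z.1).
  exact: (measurableT_comp msigma measurable_fst).
have s_gt0 (z : T) : 0 < sigma z.1 by [].
have mx : measurable_fun [set: T] snd by exact: measurable_snd.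
have mp := measurable_marginal_pdf mp0 p0_ge0 ma1 ms1 mx.
have msc := measurable_gradient_ln_marginal_pdf mp0 p0_ge0 p0_int
  ma1 ms1 s_gt0 mx.
apply: (@measurable_fun_fubini_tonelli_F _ _ R 'rV[R]_d R lebesgue_rV
  (fun z : T => (sqnorm (e z.2 z.1 + sigma z.1 *:
     gradient (fun y => ln (marginal_pdf p0 (alpha z.1) (sigma z.1) y)) z.2) *
     marginal_pdf p0 (alpha z.1) (sigma z.1) z.2)%:E)).
  apply/measurable_EFinP/measurable_funM => //; apply: measurable_sqnorm.
  apply: measurable_rV_add; last exact: measurable_rV_scale.
  exact: (me_comp mx measurable_fst).
move=> z; rewrite lee_fin mulr_ge0 ?sqnorm_ge0//.
by rewrite ltW// marginal_pdf_gt0.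
Qed.

Lemma measurable_noise_error :
  measurable_fun setT (noise_error alpha sigma X0 eps e).
Proof.
pose T := (R * Omega)%type.
pose Xt (z : T) := alpha z.1 *: X0 z.2 + sigma z.1 *: eps z.2.
have mX0 : measurable_fun [set: T] (fun z => X0 z.2).
  exact: (measurableT_comp (measurable_funP X0) measurable_snd).
have meps : measurable_fun [set: T] (fun z => eps z.2).
  exact: (measurableT_comp (measurable_funP eps) measurable_snd).
have mXt : measurable_fun [set: T] Xt.
  by apply: measurable_rV_add; apply: measurable_rV_scale => //;
    [exact: (measurableT_comp malpha measurable_fst)|
     exact: (measurableT_comp msigma measurable_fst)].
rewrite /noise_error unlock.
apply: (@measurable_fun_fubini_tonelli_F _ _ R Omega R P
  (fun z : T => (sqnorm (e (Xt z) z.1 - eps z.2))%:E)).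
  apply/measurable_EFinP/measurable_sqnorm/measurable_rV_sub => //.
  exact: (me_comp mXt measurable_fst).
by move=> z; rewrite lee_fin sqnorm_ge0.
Qed.

End error_measurability.

(** * Signs, regularity of the schedules, and integration over time *)

Lemma score_error_ge0 {R : realType} {d : nat} (alpha sigma : R -> R)
    (p0 : 'rV[R]_d -> R) e t :
  (forall x, 0 <= p0 x) -> (0 <= score_error alpha sigma p0 e t)%E.
Proof.
move=> p0_ge0; apply: integral_ge0 => x _; rewrite lee_fin.
rewrite mulr_ge0 ?sqnorm_ge0//; apply: Rintegral_ge0 => y _.
by rewrite mulr_ge0 ?gaussian_pdf_ge0.
Qed.

Lemma noise_error_ge0 {dO : measure_display} {Omega : measurableType dO}
    {R : realType} {P : probability Omega R} {d : nat} (alpha sigma : R -> R)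
    (X0 eps : {RV P >-> 'rV[R]_d}) e t :
  (0 <= noise_error alpha sigma X0 eps e t)%E.
Proof.
rewrite /noise_error unlock; apply: integral_ge0 => w _.
by rewrite lee_fin sqnorm_ge0.
Qed.

(** Differentiability gives continuity, since f(s) is the difference quotient times s - t, plus
    f(t). Continuity on the open interval then gives measurability. *)
Lemma differentiable_on_measurable {R : realType} (f : R -> R) (x y : R) :
  differentiable_on `[x, y] f -> measurable_fun `]x, y[ f.
Proof.
move=> df; apply: open_continuous_measurable_fun => [|t].
  exact: interval_open.
rewrite inE => txy; apply/continuous_withinNx.
have txy' : `[x, y]%classic t.
  exact/subset_itv_oo_cc.
have /cvg_ex[l fl] := df t txy'.
set F := within _ _ in fl.
(* At an interior point the closed interval is a neighbourhood, so the relative limit is an ordinary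
   one. *)
have F_dnbhs : t^' `=>` F.
  move=> A /= FA; rewrite /F /within/= in FA.
  have : \forall s \near t^', `[x, y]%classic s.
    apply: nbhs_dnbhs; have := near_in_itvoo txy.
    by apply: filterS => s; exact: subset_itv_oo_cc.
  by apply: filterS2 FA => s; apply.
have {}fl : ((f s - f t) / (s - t)) @[s --> t^'] --> l.
  exact: cvg_trans (cvg_app _ F_dnbhs) fl.
have st : (s - t) @[s --> t^'] --> t - t.
  by apply: cvgB; [exact: nbhs_dnbhs|exact: cvg_cst].
have ft : ((f s - f t) / (s - t) * (s - t) + f t) @[s --> t^'] -->
    l * (t - t) + f t.
  by apply: cvgD; [exact: cvgM|exact: cvg_cst].
move: ft; rewrite subrr mulr0 add0r => ft.
apply: cvg_trans ft; apply: near_eq_cvg.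
near=> s; rewrite /= -[RHS](subrK (f t)); congr (_ + _).
rewrite divfK// subr_eq0.
by near: s; exact: nbhs_dnbhs_neq.
Unshelve. all: by end_near. Qed.

Lemma measurable_patch {d d'} {T : measurableType d} {U : measurableType d'}
    (b : T -> bool) (f : T -> U) (c : U) :
  measurable_fun setT b -> measurable_fun [set x | b x] f ->
  measurable_fun setT (fun x => if b x then f x else c).
Proof.
move=> mb mf; apply: measurable_fun_if => //; rewrite setTI.
by rewrite (_ : _ @^-1` _ = [set x | b x])//; apply/seteqP; split.
Qed.

Lemma eq_add_fine_sub {R : numDomainType} (x y u v : \bar R) :
  u \is a fin_num -> v \is a fin_num ->
  (x + v = y + u -> x = y + (fine u - fine v)%:E)%E.
Proof. by move=> ufin vfin xy; rewrite EFinB !fineK// addeA -xy addeK. Qed.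

Theorem theorem4p2 (R : realType) (d : nat)
    (dO : measure_display) (Omega : measurableType dO) (P : probability Omega R)
    (X0 eps : {RV P >-> 'rV[R]_d}) (p0 : 'rV[R]_d -> R)
    (X0_density : has_density X0 p0)
    (eps_gaussian : has_density eps (gaussian_pdf 0 1))
    (X0_eps_indep : independent_RV X0 eps)
    (alpha sigma : R -> R)
    (alpha_diff : differentiable_on `[0, 1] alpha)
    (sigma_diff : differentiable_on `[0, 1] sigma)
    (alpha0 : alpha 0 = 1) (alpha1 : alpha 1 = 0)
    (sigma0 : sigma 0 = 0) (sigma1 : sigma 1 = 1)
    (alpha_ge0 : forall t : R, 0 <= t <= 1 -> 0 <= alpha t)
    (sigma_ge0 : forall t : R, 0 <= t <= 1 -> 0 <= sigma t)
    (alpha_gt0 : forall t : R, 0 < t < 1 -> 0 < alpha t)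
    (sigma_gt0 : forall t : R, 0 < t < 1 -> 0 < sigma t)
    (diffusion_ge0 : forall t : R, 0 < t < 1 ->
       0 <= derive1 (fun s => sigma s ^+ 2) t
            - 2 * (derive1 alpha t / alpha t) * sigma t ^+ 2)
    (omega : R -> R)
    (omega_meas : measurable_fun (`[0, 1] : set R) omega)
    (omega_ge0 : forall t : R, 0 <= t <= 1 -> 0 <= omega t)
    (Theta : Type) (eps_ : Theta -> 'rV[R]_d -> R -> 'rV[R]_d)
    (eps_meas : forall theta,
       measurable_fun ([set: 'rV[R]_d] `*` (`[0, 1] : set R))
         (fun z : 'rV[R]_d * R => eps_ theta z.1 z.2))
    (score_error_fin : forall theta (t : R), 0 < t < 1 ->
       score_error alpha sigma p0 (eps_ theta) t \is a fin_num)
    (noise_error_fin : forall theta (t : R), 0 < t < 1 ->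
       noise_error alpha sigma X0 eps (eps_ theta) t \is a fin_num)
    (score_loss_fin : forall theta,
       score_loss alpha sigma omega p0 (eps_ theta) \is a fin_num)
    (noise_loss_fin : forall theta,
       noise_loss alpha sigma omega X0 eps (eps_ theta) \is a fin_num) :
  exists C : R, forall theta,
    (score_loss alpha sigma omega p0 (eps_ theta) =
     noise_loss alpha sigma omega X0 eps (eps_ theta) + C%:E)%E.

Proof.
have [mp0 p0_ge0 _] := X0_density.
pose I := `]0 : R, 1[%classic.
have mI : measurable I by exact: measurable_itv.
pose in_I (t : R) : bool := 0 < t < 1.
have IE : [set t | in_I t] = I by apply/seteqP; split=> t; rewrite /I/= in_itv.
have min_I : measurable_fun setT in_I.
  by apply: measurable_and; exact: measurable_fun_ltr.
(* The data are replaced by constants outside ]0, 1[, which makes them globally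
   measurable and sigma globally positive. *)
pose al t := if in_I t then alpha t else 1.
pose sg t := if in_I t then sigma t else 1.
pose e th x t := if in_I t then eps_ th x t else 0.
have mal : measurable_fun setT al.
  apply: measurable_patch => //; rewrite IE.
  exact: differentiable_on_measurable.
have msg : measurable_fun setT sg.
  apply: measurable_patch => //; rewrite IE.
  exact: differentiable_on_measurable.
have sg_gt0 t : 0 < sg t by rewrite /sg; case: ifPn => // /sigma_gt0.
have me th : measurable_fun setT (fun z : 'rV[R]_d * R => e th z.1 z.2).
  apply: (measurable_patch (b := fun z : 'rV[R]_d * R => in_I z.2)
    (f := fun z => eps_ th z.1 z.2)).
    exact: (measurableT_comp min_I measurable_snd).
  apply: measurable_funS (eps_meas th).
    exact: measurableX.
  by move=> z /= /andP[z0 z1]; split=> //; rewrite /= in_itv/= !ltW.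
have met th t : measurable_fun setT (fun x : 'rV[R]_d => e th x t).
  have mt : measurable_fun setT (fun x : 'rV[R]_d => (x, t)).
    exact: measurable_fun_pair.
  exact: (measurableT_comp (me th) mt).
pose S th t := score_error al sg p0 (e th) t.
pose N th t := noise_error al sg X0 eps (e th) t.
have SE th t : I t -> score_error alpha sigma p0 (eps_ th) t = S th t.
  by rewrite -IE /= => It; rewrite /S /score_error /al /sg /e It.
have NE th t : I t -> noise_error alpha sigma X0 eps (eps_ th) t = N th t.
  by rewrite -IE /= => It; rewrite /N /noise_error /al /sg /e It.
have S0 th t : (0 <= S th t)%E by exact: score_error_ge0.
have N0 th t : (0 <= N th t)%E by exact: noise_error_ge0.
have mS th : measurable_fun setT (S th).
  exact: (measurable_score_error X0_density).
have mN th : measurable_fun setT (N th) by exact: measurable_noise_error.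
(* Finiteness is assumed for the original errors and carried over to the patched ones by [SE] and
   [NE]. *)
have SN th th' t : I t -> (S th t + N th' t = N th t + S th' t)%E.
  move=> It; have It' : in_I t by move: It; rewrite -IE.
  apply: (score_noise_exchange X0_density eps_gaussian X0_eps_indep) => //;
    by rewrite -/(S _ t) -/(N _ t) -?SE -?NE ?score_error_fin ?noise_error_fin.
pose J (g : R -> \bar R) :=
  (\int[lebesgue_measure]_(t in I) ((omega t)%:E * g t))%E.
have momega : measurable_fun I (EFin \o omega).
  apply/measurable_EFinP; apply: measurable_funS omega_meas => //.
  exact: subset_itv_oo_cc.
have omega0 t : I t -> (0 <= (omega t)%:E)%E.
  by rewrite -IE /= => /andP[t0 t1]; rewrite lee_fin omega_ge0// !ltW.
(* Additivity rests on nonnegativity and measurability; no finiteness of [J g] or [J h] is used. *)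
have JD g h : measurable_fun setT g -> measurable_fun setT h ->
    (forall t, (0 <= g t)%E) -> (forall t, (0 <= h t)%E) ->
    (J g + J h =
     \int[lebesgue_measure]_(t in I) ((omega t)%:E * (g t + h t)))%E.
  move=> mg mh g0 h0; rewrite -ge0_integralD//.
  - by apply: eq_integral => t _; rewrite ge0_muleDr.
  - by move=> t It; rewrite mule_ge0 ?omega0.
  - by apply: emeasurable_funM => //; exact: measurable_funTS.
  - by move=> t It; rewrite mule_ge0 ?omega0.
  - by apply: emeasurable_funM => //; exact: measurable_funTS.
(* The endpoints are negligible, and inside the interval the patched errors equal the original
   ones. *)
have JE (f g : R -> \bar R) : measurable_fun setT g ->
    (forall t, I t -> f t = g t) ->
    (\int[lebesgue_measure]_(t in `[0%R, 1%R]) ((omega t)%:E * f t) = J g)%E.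
  move=> mg fg; rewrite integral_itv_bndoo; last first.
    apply: (@eq_measurable_fun _ _ _ _ _ (fun t => (omega t)%:E * g t)%E).
      by move=> t /[!inE] It; rewrite fg.
    by apply: emeasurable_funM => //; exact: measurable_funTS.
  by apply: eq_integral => t /[!inE] It; rewrite fg.
have score_lossE th : score_loss alpha sigma omega p0 (eps_ th) =
    ((2^-1)%:E * J (S th))%E.
  by rewrite -(JE _ _ (mS th) (SE th)).
have noise_lossE th : noise_loss alpha sigma omega X0 eps (eps_ th) =
    ((2^-1)%:E * J (N th))%E.
  by rewrite -(JE _ _ (mN th) (NE th)).
have J0 g : (forall t, (0 <= g t)%E) -> (0 <= J g)%E.
  by move=> g0; apply: integral_ge0 => t It; rewrite mule_ge0 ?omega0.
(* This is the pointwise exchange identity [SN], weighted by [omega], integrated and halved. *)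
have losses th th' : (score_loss alpha sigma omega p0 (eps_ th) +
      noise_loss alpha sigma omega X0 eps (eps_ th') =
    noise_loss alpha sigma omega X0 eps (eps_ th) +
      score_loss alpha sigma omega p0 (eps_ th'))%E.
  rewrite !score_lossE !noise_lossE -!ge0_muleDr ?J0// !JD//; congr (_ * _)%E.
  by apply: eq_integral => t /[!inE] It; rewrite SN.
(* The constant is the gap between the two losses at a reference parameter [th0]; if [Theta] is
   empty, any constant works. *)
have [[th0 _]|noTheta] := pselect (exists th : Theta, True); last first.
  by exists 0 => th; case: noTheta; exists th.
exists (fine (score_loss alpha sigma omega p0 (eps_ th0)) -
        fine (noise_loss alpha sigma omega X0 eps (eps_ th0))) => th.
exact: eq_add_fine_sub (score_loss_fin th0) (noise_loss_fin th0)
  (losses th th0).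
Qed.
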